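(* Let $$\Psi(\mathfrak{a};z)=\Psi_1(\mathfrak{a})\mathbf{1}_{z<1}(z)+\Psi_2(\mathfrak{a})\mathbf{1}_{z\ge1}(z)+\Theta(z),\qquad \mathfrak{a}\ge0,\ z\ge0,$$ where $\Psi_1:[0,\infty)\to\mathbb{R}$ is non-decreasing, $\Psi_2:[0,\infty)\to\mathbb{R}$ is non-increasing, both $\Psi_1$ and $\Psi_2$ are locally Lipschitz-continuous, $\Theta:[0,\infty)\to\mathbb{R}$ is measurable, and for some constants $A_1,A_2$ $$0<A_1\le\Psi(\mathfrak{a};z)\le A_2<1,\qquad A_1\le\Theta(z)\le A_2$$ for all $\mathfrak{a},z\ge0$. Then $$\rho(a,b;x,y)=|x-y|^{-N-\Psi(|a-b|;|x-y|)}$$ is a homogeneous jump kernel.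
   Context: Homogeneous jump kernel: a function $\rho:(\mathbb{R}\times\mathbb{R})\times(\mathbb{R}^N\times\mathbb{R}^N)\to\mathbb{R}$, written $\rho(a,b;x,y)$, such that for all $a,b,c,d\in\mathbb{R}$ and almost every $(x,y)\in\mathbb{R}^N\times\mathbb{R}^N$: (A1) $\rho$ is a non-negative Borel function; (A2) $\rho(a,b;x,y)=\rho(b,a;y,x)$; (A3) $(a-b)\rho(a,b;x,y)\ge(c-d)\rho(c,d;x,y)$ whenever $a\ge c\ge d\ge b$; (A4) $\rho(a,b;x,y)=\rho(a,b;|x-y|)$, i.e. $\rho$ depends on $x,y$ only through $|x-y|$; (A5) for every $R>0$ there is a function $m_R:[0,\infty)\to[0,\infty)$ such that $\sup_{-R\le a,b\le R}\rho(a,b;x,y)\le m_R(|x-y|)$ and $\int_{\mathbb{R}^N}(1\wedge|y|)\,m_R(|y|)\,dy=K_R<\infty$; (A6) $\rho$ is continuous with respect to the first two variables, and for every $\varepsilon>0$ and every $R>\varepsilon$ there is a constant $C_{R,\varepsilon}$ such that $|\rho(a,b;x,y)-\rho(c,d;x,y)|\le C_{R,\varepsilon}(|a-c|+|b-d|)\,m_R(|x-y|)$ for all $a,b,c,d\in[-R,R]$ with $|a-b|\ge\varepsilon$ and $|c-d|\ge\varepsilon$. Measurable functions here are understood as Borel measurable. The value of $\rho$ on the null set $\{x=y\}$ is irrelevant. *)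

(* Defs.v *)
From HB Require Import structures.
From mathcomp Require Import all_boot all_order all_algebra.
From mathcomp Require Import all_classical all_reals all_analysis.

Set Implicit Arguments.
Unset Strict Implicit.
Unset Printing Implicit Defensive.

Import Order.TTheory GRing.Theory Num.Theory.
Import numFieldNormedType.Exports.

Local Open Scope classical_set_scope.
Local Open Scope ring_scope.

(* Points of R^N are N-tuples: the library puts on N.-tuple R the sigma-algebra
   generated by the coordinates, that is, the Borel sigma-algebra. *)

Definition cons_pair (R : realType) (n : nat) (p : R * n.-tuple R) :
  n.+1.-tuple R := [tuple of p.1 :: p.2].

(* Lebesgue measure on R^N, as the N-fold product of the one on R. *)
Fixpoint lebesgue_tuple (R : realType) (N : nat) : set (N.-tuple R) -> \bar R :=
  match N with
  | 0 => \d_ [tuple]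
  | n.+1 => pushforward ((@lebesgue_measure R) \x (@lebesgue_tuple R n))%E
                        (@cons_pair R n)
  end.

Section lebesgue_tuple_measure.
Variable R : realType.
Implicit Type n N : nat.

Lemma measurable_cons_pair n :
  measurable_fun [set: R * n.-tuple R] (@cons_pair R n).
Proof. exact: measurable_cons. Qed.

Definition uncons_pair n (t : n.+1.-tuple R) : R * n.-tuple R :=
  (thead t, [tuple of behead t]).

Lemma measurable_uncons_pair n : measurable_fun setT (@uncons_pair n).
Proof.
apply/measurable_fun_pairP; split.
  exact: measurable_tnth.
exact: measurable_behead.
Qed.

Lemma cons_pairK n : cancel (@cons_pair R n) (@uncons_pair n).
Proof. by move=> [x t]; congr pair; apply/val_inj. Qed.

Lemma uncons_pairK n : cancel (@uncons_pair n) (@cons_pair R n).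
Proof. by move=> t; rewrite /cons_pair /= -tuple_eta. Qed.



Section step.
Variables (n : nat) (mu : {sigma_finite_measure set (n.-tuple R) -> \bar R}).

Let prod_mu : {measure set _ -> \bar R} := (@lebesgue_measure R \x mu)%E.

Let prod_mu_sigma_finite : sigma_finite setT prod_mu.
Proof.
have /sigma_finiteP[F [TF ndF Foo]] := sigma_finiteT (@lebesgue_measure R).
have /sigma_finiteP[G [TG ndG Goo]] := sigma_finiteT mu.
exists (fun k => F k `*` G k).
  rewrite -setXTT TF TG predeqE => -[x y]; split.
    move=> [/= [k _ Fkx] [l _ Gly]]; exists (maxn k l) => //; split.
    - by move: x Fkx; exact/subsetPset/ndF/leq_maxl.
    - by move: y Gly; exact/subsetPset/ndG/leq_maxr.
  by move=> [k _ []/= ? ?]; split; exists k.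
move=> k; have [? ?] := Foo k; have [? ?] := Goo k.
split; first exact: measurableX.
by rewrite /prod_mu /= product_measure1E// lte_mul_pinfty// ge0_fin_numE.
Qed.

Let nu : set (n.+1.-tuple R) -> \bar R := pushforward prod_mu (@cons_pair R n).

Let nu0 : nu set0 = 0%E.
Proof. by rewrite /nu /pushforward preimage_set0 measure0. Qed.

Let nu_ge0 A : (0 <= nu A)%E. Proof. exact: (measure_ge0 prod_mu). Qed.

Let nu_sigma_additive : semi_sigma_additive nu.
Proof.
have := @measure_semi_sigma_additive _ _ _ (pushforward prod_mu (@cons_pair R n)).
by apply; exact: measurable_cons_pair.
Qed.

HB.instance Definition _ := isMeasure.Build _ _ _ nu
  nu0 nu_ge0 nu_sigma_additive.

Let nu_sigma_finite : sigma_finite setT nu.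
Proof.
have [F UF Foo] := prod_mu_sigma_finite.
exists (fun k => @uncons_pair n @^-1` F k).
  by rewrite -preimage_bigcup -UF preimage_setT.
move=> k; have [mF Fk] := Foo k; split.
  by rewrite -[X in measurable X]setTI; exact: measurable_uncons_pair.
rewrite /nu /pushforward -comp_preimage (_ : _ \o _ = id) //.
by apply/funext => p; exact: cons_pairK.
Qed.

HB.instance Definition _ := Measure_isSigmaFinite.Build _ _ _ nu
  nu_sigma_finite.

Definition lebesgue_step :
  {sigma_finite_measure set (n.+1.-tuple R) -> \bar R} := nu.

End step.

Fixpoint lebesgue_bundle N : {sigma_finite_measure set (N.-tuple R) -> \bar R} :=
  match N with
  | 0 => \d_ [tuple]
  | n.+1 => lebesgue_step (lebesgue_bundle n)
  end.

Lemma lebesgue_bundleE N : @lebesgue_tuple R N = lebesgue_bundle N.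
Proof. by elim: N => [//|n IHn] /=; rewrite IHn. Qed.

Let lt0 N : @lebesgue_tuple R N set0 = 0%E.
Proof. by rewrite lebesgue_bundleE measure0. Qed.

Let lt_ge0 N A : (0 <= @lebesgue_tuple R N A)%E.
Proof. by rewrite lebesgue_bundleE. Qed.

Let lt_sigma_additive N : semi_sigma_additive (@lebesgue_tuple R N).
Proof. by rewrite lebesgue_bundleE; exact: measure_semi_sigma_additive. Qed.

HB.instance Definition _ N := isMeasure.Build _ _ _ (@lebesgue_tuple R N)
  (lt0 N) (@lt_ge0 N) (@lt_sigma_additive N).

Let lt_sigma_finite N : sigma_finite setT (@lebesgue_tuple R N).
Proof. by rewrite lebesgue_bundleE; exact: sigma_finiteT. Qed.

HB.instance Definition _ N := Measure_isSigmaFinite.Build _ _ _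
  (@lebesgue_tuple R N) (@lt_sigma_finite N).

Lemma lebesgue_tuple_box N (A : 'I_N -> set R) :
  (forall i, measurable (A i)) ->
  lebesgue_tuple [set t : N.-tuple R | forall i, A i (tnth t i)]
    = (\prod_(i < N) lebesgue_measure (A i))%E.
Proof.
elim: N A => [|n IHn] A mA.
  by rewrite big_ord0 /= diracE mem_set//; case.
rewrite big_ord_recl -IHn//.
set B := [set t : n.-tuple R | _].
have mB : measurable B.
  rewrite (_ : B = \bigcap_(i in [set: 'I_n])
      ((fun t : n.-tuple R => tnth t i) @^-1` A (lift ord0 i))); last first.
    by apply/seteqP; split=> [t At i _|t At i]; exact: At.
  apply: fin_bigcap_measurable => // i _.
  by rewrite -[X in measurable X]setTI; exact: measurable_tnth.
transitivity (((@lebesgue_measure R) \x (@lebesgue_tuple R n))%E (A ord0 `*` B));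
  last exact: (product_measure1E (@lebesgue_measure R) (@lebesgue_tuple R n)
    (mA ord0) mB).
apply: (congr1 ((@lebesgue_measure R) \x (@lebesgue_tuple R n))%E).
apply/seteqP; split=> [[x t] At|[x t] [Ax At] i].
  split=> [|i]; first exact: (At ord0).
  by have := At (lift ord0 i); rewrite /= tnthS.
by have [j ->|->] := unliftP ord0 i; [rewrite /= tnthS; exact: At|].
Qed.

End lebesgue_tuple_measure.

Section jump_kernel.
Variables (R : realType) (N : nat).

Definition eucl_norm (x : N.-tuple R) : R := Num.sqrt (\sum_(i < N) tnth x i ^+ 2).

Definition eucl_dist (x y : N.-tuple R) : R :=
  Num.sqrt (\sum_(i < N) (tnth x i - tnth y i) ^+ 2).

(* The value rho (a, b; x, y) is written rho ((a, b), (x, y)). Almost everywhere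
   refers to Lebesgue measure on R^N * R^N, with a null set that does not depend
   on the real arguments. In jump_kernel_bound, the measurability of m_r is what
   gives a meaning to its integral. *)
Record homogeneous_jump_kernel
    (rho : (R * R) * (N.-tuple R * N.-tuple R) -> R) : Prop := {
  jump_kernel_ge0 : forall p, 0 <= rho p;
  jump_kernel_measurable : measurable_fun setT rho;
  jump_kernel_sym :
    \forall xy \ae (@lebesgue_tuple R N \x @lebesgue_tuple R N)%E,
      forall a b : R, rho ((a, b), xy) = rho ((b, a), (xy.2, xy.1));
  jump_kernel_monotone :
    \forall xy \ae (@lebesgue_tuple R N \x @lebesgue_tuple R N)%E,
      forall a b c d : R, d <= c -> c <= a -> b <= d ->
        (c - d) * rho ((c, d), xy) <= (a - b) * rho ((a, b), xy);
  jump_kernel_radial :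
    exists rho0 : R -> R -> R -> R,
    \forall xy \ae (@lebesgue_tuple R N \x @lebesgue_tuple R N)%E,
      forall a b : R, rho ((a, b), xy) = rho0 a b (eucl_dist xy.1 xy.2);
  jump_kernel_continuous :
    \forall xy \ae (@lebesgue_tuple R N \x @lebesgue_tuple R N)%E,
      continuous (fun ab : R * R => rho (ab, xy));
  jump_kernel_bound :
    exists m : R -> R -> R,
      (forall r : R, 0 < r ->
        [/\ forall t : R, 0 <= t -> 0 <= m r t,
            measurable_fun (`[0, +oo[%classic : set R) (m r),
            \forall xy \ae (@lebesgue_tuple R N \x @lebesgue_tuple R N)%E,
              (ereal_sup [set (rho ((a, b), xy))%:E |
                  a in `[(- r)%R, r]%classic & b in `[(- r)%R, r]%classic]
                <= (m r (eucl_dist xy.1 xy.2))%:E)%E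
          & (\int[@lebesgue_tuple R N]_y
              (Num.min 1 (eucl_norm y) * m r (eucl_norm y))%:E < +oo)%E])
      /\
      (forall eps r : R, 0 < eps -> eps < r ->
        exists C : R,
        \forall xy \ae (@lebesgue_tuple R N \x @lebesgue_tuple R N)%E,
          forall a b c d : R,
            a \in `[- r, r] -> b \in `[- r, r] ->
            c \in `[- r, r] -> d \in `[- r, r] ->
            eps <= `|a - b| -> eps <= `|c - d| ->
            `|rho ((a, b), xy) - rho ((c, d), xy)|
              <= C * (`|a - c| + `|b - d|) * m r (eucl_dist xy.1 xy.2))
}.

End jump_kernel.

Definition locally_lipschitz_on (R : realType) (A : set R) (f : R -> R) : Prop :=
  forall x, A x -> exists2 U, nbhs x U & [lipschitz f y | y in U `&` A].

Definition piecewise_exponent (R : realType) (Psi1 Psi2 Theta : R -> R)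
    (s z : R) : R :=
  Psi1 s * \1_[set t | t < 1] z + Psi2 s * \1_[set t | 1 <= t] z + Theta z.

(* Main.v *)
Require Import Defs.
From HB Require Import structures.
From mathcomp Require Import all_boot all_order all_algebra.
From mathcomp Require Import all_classical all_reals all_analysis.
From mathcomp Require Import measurable_realfun.
From mathcomp Require Import ring lra.

Set Implicit Arguments.
Unset Strict Implicit.
Unset Printing Implicit Defensive.

Import Order.TTheory GRing.Theory Num.Theory.
Import numFieldNormedType.Exports.

Local Open Scope classical_set_scope.
Local Open Scope ring_scope.

(** Write z for |x - y| and s for |a - b|, so that the kernel is z^(-N - Psi(s; z)).
    It is symmetric because s and z are, and it is monotone because the exponent
    moves the right way on each side of z = 1: where z < 1 powers of z decrease
    with the exponent and Psi(.; z) = Psi1 + const increases, where z >= 1 powers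
    of z increase with the exponent and Psi(.; z) = Psi2 + const decreases.
    Continuity comes from that of Psi1 and Psi2, and measurability from it and the
    measurability of Theta.  All this holds for every pair (x, y), since the kernel
    vanishes where z = 0.

    The substance is the choice of one majorant m, which must dominate the kernel,
    dominate its increments in (a, b), and be integrable against min(1, |y|).  The
    crude bound A1 <= Psi <= A2 gives z^(-N - A2) for z < 1 and z^(-N - A1) for
    z >= 1, but an increment of the exponent costs a factor |ln z|
    ([powR_dist_le]).  A logarithm is absorbed by an arbitrarily small power
    ([mulr_ln_le_powR]), so the exponents are relaxed to some be in ]A2, 1[ and
    some al in ]0, A1[; the resulting function [split_power] controls both the
    kernel and its increments ([powR_le_split_power], [powR_dist_split_power]).
    It does not depend on the bound r on the arguments, which enters only through
    the Lipschitz constant of Psi1 and Psi2 on [0, 2 r]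
    ([lipschitz_piecewise_exponent]).

    Integrability uses dyadic shells in place of polar coordinates.  The shell
    of radius about h is contained in a cube of volume of order h^N; on it the
    integrand is of order h^(1 - N - be) when h is small and h^(-N - al) when h is
    large.  The contributions h^(1 - be), for h = 2^-k, and h^-al, for h = 2^k, are
    geometric and summable because be < 1 and al > 0
    ([split_power_integral_lty]). *)

(** * Locally Lipschitz functions *)

Lemma lipschitz_constant (R : realType) (A : set R) (f : R -> R) :
  [lipschitz f y | y in A] ->
  exists2 k, 0 < k & forall x y, A x -> A y -> `|f x - f y| <= k * `|x - y|.
Proof.
move=> /pinfty_ex_gt0[k k0 kf]; exists k => // x y Ax Ay.
by have := kf (x, y); apply.
Qed.

Lemma locally_lipschitz_onS (R : realType) (A B : set R) (f : R -> R) :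
  B `<=` A -> locally_lipschitz_on A f -> locally_lipschitz_on B f.
Proof.
move=> BA lf x /BA/lf[U Ux Uf]; exists U => //.
apply: sub_lipschitz Uf => P PU z [[Uz1 Bz1] [Uz2 Bz2]].
by apply: PU; split; split => //; exact: BA.
Qed.

Lemma locally_lipschitz_near (R : realType) (A : set R) (f : R -> R) x :
  locally_lipschitz_on A f -> A x ->
  exists2 k, 0 < k &
    \forall y \near x, A y -> `|f y - f x| <= k * `|y - x|.
Proof.
move=> lf Ax; have [U Ux /lipschitz_constant[k k0 fk]] := lf x Ax.
exists k => //; apply: filterS (Ux) => y Uy Ay.
by apply: fk; split=> //; exact: nbhs_singleton Ux.
Qed.

Lemma locally_lipschitz_cvg (R : realType) (A : set R) (f : R -> R) x :
  locally_lipschitz_on A f -> A x -> f y @[y --> within A (nbhs x)] --> f x.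
Proof.
move=> lf Ax; have [k k0 fk] := locally_lipschitz_near lf Ax.
apply/cvgrPdist_le => e e0.
have ke0 : 0 < k^-1 * e by rewrite mulr_gt0// invr_gt0.
have /cvgrPdist_le/(_ _ ke0) xke : id y @[y --> x] --> x by exact: cvg_id.
rewrite near_withinE; apply: filterS2 fk xke => y fy yx /fy{}fy.
by rewrite distrC (le_trans fy)// -ler_pdivlMl// distrC.
Qed.

(** A uniform constant is obtained by covering the compact set A * A.  Near the
    diagonal the local constants serve.  Near a pair (x, y) with x <> y the
    distance is bounded below and the increments of f are bounded above, so any
    large enough constant serves; covering pairs rather than points avoids both
    a Lebesgue number and an interval structure on A. *)
Lemma compact_locally_lipschitz (R : realType) (A : set R) (f : R -> R) :
  compact A -> locally_lipschitz_on A f ->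
  exists2 k, 0 < k & forall x y, A x -> A y -> `|f x - f y| <= k * `|x - y|.
Proof.
move=> cA lf; have := compact_setX cA cA.
move=> /compact_near_coveringP/near_covering_withinP.
move=> /(_ R +oo (fun k p => `|f p.1 - f p.2| <= k * `|p.1 - p.2|) _) cov.
suff /cov/pinfty_ex_gt0[k k0 fk] : forall p, (A `*` A) p ->
    \forall q \near p & k \near +oo,
      (A `*` A) q -> `|f q.1 - f q.2| <= k * `|q.1 - q.2|.
  by exists k => // x y Ax Ay; exact: (fk (x, y)).
move=> [x y] [/= Ax Ay]; have [<-{y Ay}|xy] := eqVneq x y.
  have [U Ux /lipschitz_constant[l l0 fl]] := lf x Ax.
  exists (U `*` U, [set k | l <= k]) => /=.
    by split; [exists (U, U)|apply: nbhs_pinfty_ge; rewrite num_real].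
  move=> [[u v] k] [[/= Uu Uv] lk] [Au Av].
  by rewrite (le_trans (fl _ _ _ _))// ler_wpM2r.
(* Moving each point by at most a quarter of the distance leaves half of it. *)
pose d := `|x - y| / 4; have d0 : 0 < d by rewrite divr_gt0// normr_gt0 subr_eq0.
pose V z := [set u | `|z - u| <= d /\ (A u -> `|f u - f z| <= 1)].
have Vz z : A z -> nbhs z (V z).
  move=> Az; have /cvgrPdist_le/(_ 1 ltr01)/= fz := locally_lipschitz_cvg lf Az.
  apply: filterI.
    by have /cvgrPdist_le/(_ _ d0) : id u @[u --> z] --> z by exact: cvg_id.
  move: fz; rewrite near_withinE; apply: filterS => u fu Au; rewrite distrC.
  exact: fu.
pose M := (2 + `|f x - f y|) / (2 * d).
exists (V x `*` V y, [set k | M <= k]) => /=.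
  split; first by exists (V x, V y) => //; split; exact: Vz.
  by apply: nbhs_pinfty_ge; rewrite num_real.
move=> [[u v] k] [[/= [xu fu] [yv fv]] Mk] [/fu{}fu /fv{}fv].
have duv : 2 * d <= `|u - v|.
  have : `|x - y| <= `|x - u| + `|u - v| + `|y - v|.
    have -> : x - y = (x - u) + (u - v) - (y - v) by ring.
    by rewrite (le_trans (ler_normB _ _))// lerD2r ler_normD.
  have : `|x - y| = 4 * d by rewrite /d mulrC divfK.
  lra.
apply: le_trans (_ : M * (2 * d) <= _); last first.
  by apply: ler_pM => //; [rewrite divr_ge0 ?addr_ge0//|]; lra.
rewrite divfK; last by rewrite mulf_neq0// gt_eqF.
have -> : f u - f v = (f u - f x) + (f x - f y) - (f v - f y) by ring.
rewrite (le_trans (ler_normB _ _))// (le_trans (lerD (ler_normD _ _) fv))//.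
lra.
Qed.

(** * The majorant and the power estimates *)

(** Since 1 + r <= expR r, an increment of the convex function u |-> t^u is at
    most the increment of u times the larger of the two slopes. *)
Lemma powR_dist_le (R : realType) (t u v w : R) : 0 < t ->
  t `^ u <= t `^ w -> t `^ v <= t `^ w ->
  `|t `^ u - t `^ v| <= `|u - v| * (`|ln t| * t `^ w).
Proof.
move=> t0; wlog uv : u v / t `^ v <= t `^ u.
  move=> H uw vw; have [vu|/ltW vu] := leP (t `^ v) (t `^ u); first exact: H.
  by rewrite distrC (distrC u); exact: H.
move=> uw vw; rewrite ger0_norm ?subr_ge0// mulrA -normrM.
have vE : t `^ v = t `^ u * t `^ (v - u).
  by rewrite -powRD ?(gt_eqF t0) ?implybT// subrKC.
rewrite vE -[X in X - _]mulr1 -mulrBr mulrC ler_pM ?powR_ge0//.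
  by rewrite subr_ge0 -(ler_pM2l (powR_gt0 u t0)) mulr1 -vE.
have : 1 + (v - u) * ln t <= t `^ (v - u).
  by rewrite /powR gt_eqF//; exact: expR_ge1Dx.
have := ler_norm ((u - v) * ln t); lra.
Qed.

(** Taking r of the sign of ln t bounds |ln t| by an arbitrarily small power of t
    at infinity, and of 1 / t at the origin. *)
Lemma mulr_ln_le_powR (R : realType) (t r : R) : 0 < t -> r * ln t <= t `^ r.
Proof. by move=> t0; rewrite -ln_powR ltW// ln_sublinear// powR_gt0. Qed.

(** The separate exponents on the two sides of 1 make this function integrable
    against min(1, |y|) both at the origin, if be < 1, and at infinity, if
    al > 0. *)
Definition split_power (R : realType) (N : nat) (al be t : R) : R :=
  t `^ (- N%:R - (if t < 1 then be else al)).

Lemma split_power_ge0 (R : realType) N (al be t : R) : 0 <= split_power N al be t.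
Proof. exact: powR_ge0. Qed.

Lemma measurable_split_power (R : realType) N (al be : R) :
  measurable_fun setT (split_power N al be).
Proof.
rewrite /split_power [X in measurable_fun _ X](_ : _ = fun t =>
    if t < 1 then t `^ (- N%:R - be) else t `^ (- N%:R - al)); last first.
  by apply/funext => t; case: ifPn.
apply: measurable_fun_ifT; first exact: measurable_fun_ltr.
  exact: measurable_powR.
exact: measurable_powR.
Qed.

Lemma powR_le_split_power (R : realType) N (al be A1 A2 t p : R) :
  al < A1 -> A2 < be -> 0 <= t -> - N%:R - p != 0 -> A1 <= p <= A2 ->
  t `^ (- N%:R - p) <= split_power N al be t.
Proof.
move=> alA1 A2be; rewrite le_eqVlt => /predU1P[<-|t0] p0 /andP[A1p pA2].
  by rewrite powR0// split_power_ge0.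
rewrite /split_power; have [t1|t1] := ltP t 1.
  by rewrite ger_powR ?t0 ?(ltW t1)// lerD2l lerN2; lra.
by rewrite ler_powR// lerD2l lerN2; lra.
Qed.

(** The gaps be - A2 and A1 - al between the range of the exponents and those of
    the majorant are what pays for the factor |ln t| produced by differentiating
    in the exponent. *)
Lemma powR_dist_split_power (R : realType) N (al be A1 A2 t p q : R) :
  al < A1 -> A2 < be -> 0 <= t ->
  - N%:R - p != 0 -> - N%:R - q != 0 -> A1 <= p <= A2 -> A1 <= q <= A2 ->
  `|t `^ (- N%:R - p) - t `^ (- N%:R - q)| <=
    ((be - A2)^-1 + (A1 - al)^-1) * `|p - q| * split_power N al be t.
Proof.
move=> alA1 A2be; have be0 : 0 < be - A2 by lra.
have al0 : 0 < A1 - al by lra.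
rewrite le_eqVlt => /predU1P[<-|t0] p0 q0 /andP[A1p pA2] /andP[A1q qA2].
  rewrite !powR0// subr0 normr0 !mulr_ge0// ?split_power_ge0//.
  by rewrite addr_ge0// invr_ge0 ltW.
have tD r s : t `^ (r + s) = t `^ r * t `^ s.
  by rewrite powRD// (gt_eqF t0) implybT.
have -> : `|p - q| = `|(- N%:R - p) - (- N%:R - q)|.
  by rewrite distrC; congr `|_|; ring.
rewrite /split_power; have [t1|t1] := ltP t 1.
  apply: le_trans (powR_dist_le (w := - N%:R - A2) t0 _ _) _.
  - by rewrite ger_powR ?t0 ?(ltW t1)// lerD2l lerN2; lra.
  - by rewrite ger_powR ?t0 ?(ltW t1)// lerD2l lerN2; lra.
  rewrite [leRHS]mulrAC mulrC ler_wpM2r//.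
  have -> : - N%:R - be = (A2 - be) + (- N%:R - A2) by ring.
  rewrite tD mulrA ler_wpM2r ?powR_ge0//.
  have := mulr_ln_le_powR (A2 - be) t0.
  rewrite ler0_norm ?ln_le0 ?(ltW t1)// => h.
  rewrite mulrDl ler_wpDr ?mulr_ge0 ?powR_ge0 ?invr_ge0 ?(ltW al0)//.
  by rewrite ler_pdivlMl//; lra.
apply: le_trans (powR_dist_le (w := - N%:R - A1) t0 _ _) _.
- by rewrite ler_powR// lerD2l lerN2; lra.
- by rewrite ler_powR// lerD2l lerN2; lra.
rewrite [leRHS]mulrAC mulrC ler_wpM2r//.
have -> : - N%:R - al = (A1 - al) + (- N%:R - A1) by ring.
rewrite tD mulrA ler_wpM2r ?powR_ge0//.
have := mulr_ln_le_powR (A1 - al) t0.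
rewrite ger0_norm ?ln_ge0// => h.
rewrite mulrDl ler_wpDl ?mulr_ge0 ?powR_ge0 ?invr_ge0 ?(ltW be0)//.
by rewrite ler_pdivlMl.
Qed.

(** * Integration by geometric covers *)

Lemma geometric_nneseries_lty (R : realType) (a q : R) :
  0 <= q < 1 -> (\sum_(0 <= k <oo) (a * q ^+ k)%:E < +oo)%E.
Proof.
move=> /andP[q0 q1].
have cv := @cvg_geometric_series _ a q; rewrite ger0_norm// in cv.
have -> : (\sum_(0 <= k <oo) (a * q ^+ k)%:E = (a * (1 - q)^-1)%:E)%E.
  apply/cvg_lim => //; under eq_fun do rewrite sumEFin.
  by apply: cvg_EFin; [exact: nearW|exact: cv q1].
exact: ltry.
Qed.

(** The function is dominated by the series of the c k * \1_(B k), of which one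
    term already suffices at each point; the sets B k may overlap, so that shells
    can be replaced by the cubes that contain them. *)
Lemma integral_cover_lty d (T : measurableType d) (R : realType)
    (mu : {measure set T -> \bar R}) (D : set T) (f : T -> \bar R)
    (B : nat -> set T) (c : nat -> R) (a q : R) :
  measurable D -> measurable_fun D f -> (forall x, D x -> (0 <= f x)%E) ->
  (forall k, measurable (B k)) -> (forall k, 0 <= c k) ->
  (forall k, (c k)%:E * mu (B k) = (a * q ^+ k)%:E)%E ->
  0 <= q < 1 ->
  (forall x, D x -> exists2 k, B k x & (f x <= (c k)%:E)%E) ->
  (\int[mu]_(x in D) f x < +oo)%E.
Proof.
move=> mD mf f0 mB c0 cB q01 fB.
have cB0 k x : (0 <= (c k * \1_(B k) x)%:E)%E by rewrite lee_fin mulr_ge0.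
have mcB k : measurable_fun D (fun x => (c k * \1_(B k) x)%:E).
  by apply/measurable_EFinP/measurable_funM => //; exact: measurable_indic.
apply: (@le_lt_trans _ _
    (\int[mu]_(x in D) (\sum_(0 <= k <oo) (c k * \1_(B k) x)%:E))%E).
  apply: ge0_le_integral => //.
    by apply: ge0_emeasurable_sum => // k x _ _; exact: cB0.
  move=> x /fB[k Bx /le_trans]; apply.
  rewrite (nneseriesD1 (n := k))//= indicE mem_set// mulr1 leeDl//.
  exact: nneseries_ge0.
rewrite integral_nneseries//.
apply: le_lt_trans (geometric_nneseries_lty a q01).
apply: lee_nneseries => k _; first by move=> _; exact: integral_ge0.
rewrite (integralZl_indic mD (fun=> B k))//; last by rewrite ltNge c0.
rewrite integral_indic// -cB; apply: lee_wpmul2l; first by rewrite lee_fin.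
by apply: le_measure; rewrite ?inE//; exact: measurableI.
Qed.

(** * Cubes and dyadic scales *)

Section eucl.
Context {R : realType}.

Lemma tnth_le_eucl_norm N (y : N.-tuple R) i : `|tnth y i| <= eucl_norm y.
Proof.
rewrite /eucl_norm -sqrtr_sqr ler_wsqrtr// (bigD1 i)//= lerDl.
by apply: sumr_ge0 => j _; exact: sqr_ge0.
Qed.

Lemma measurable_eucl_norm N : measurable_fun setT (@eucl_norm R N).
Proof.
apply: measurableT_comp => //.
  by apply: continuous_measurable_fun; exact: sqrt_continuous.
apply: measurable_sum => i; apply: measurable_funX; exact: measurable_tnth.
Qed.

Lemma measurable_eucl_dist N :
  measurable_fun setT (fun xy : N.-tuple R * N.-tuple R => eucl_dist xy.1 xy.2).
Proof.
rewrite /eucl_dist; apply: measurableT_comp => /=.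
  by apply: continuous_measurable_fun; exact: sqrt_continuous.
apply: measurable_sum => i; apply: measurable_funX; apply: measurable_funB.
  apply: (measurableT_comp (measurable_tnth i)); exact: measurable_fst.
apply: (measurableT_comp (measurable_tnth i)); exact: measurable_snd.
Qed.

Definition cube N (h : R) : set (N.-tuple R) :=
  [set y | forall i, (`[- h, h]%classic : set R) (tnth y i)].

Lemma eucl_norm_cube N h (y : N.-tuple R) : eucl_norm y <= h -> cube h y.
Proof.
by move=> yh i; rewrite /= in_itv/= -ler_norml (le_trans (tnth_le_eucl_norm _ _)).
Qed.

Lemma measurable_cube N h : measurable (@cube N h).
Proof.
rewrite (_ : @cube N h = \bigcap_(i in [set: 'I_N])
    ((fun y : N.-tuple R => tnth y i) @^-1` `[- h, h])); last first.
  by apply/seteqP; split=> [y yh i _|y yh i]; exact: yh.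
apply: fin_bigcap_measurable => // i _.
by rewrite -[X in measurable X]setTI; exact: measurable_tnth.
Qed.

Lemma lebesgue_tuple_cube N h : 0 <= h ->
  lebesgue_tuple (@cube N h) = ((2 * h) ^+ N)%:E.
Proof.
move=> h0; rewrite /cube (lebesgue_tuple_box (A := fun=> `[- h, h]%classic))//.
under eq_bigr do rewrite lebesgue_measure_itv/= lte_fin.
rewrite (eq_bigr (fun=> (2 * h)%:E)) => [|i _].
  by rewrite prodEFin prodr_const card_ord.
move: h0; rewrite le_eqVlt => /predU1P[<-|h0]; first by rewrite oppr0 ltxx mulr0.
by rewrite gtrN// -EFinD opprK mulr2n mulrDl mul1r.
Qed.

End eucl.

Lemma dyadic_ge1 (R : realType) (t : R) : 1 <= t ->
  exists k, 2 ^+ k <= t < 2 ^+ k.+1.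
Proof.
move=> t1; have t0 : 0 <= t by rewrite (le_trans ler01).
have t1' : (0 < Num.truncn t)%N by rewrite truncn_gt0.
have /andP[lo hi] := trunc_log_bounds (isT : (1 < 2)%N) t1'.
have /andP[tlo thi] := truncn_itv t0.
exists (trunc_log 2 (Num.truncn t)); rewrite -!natrX.
rewrite (le_trans _ tlo) ?ler_nat//=.
by rewrite (lt_le_trans thi)// ler_nat.
Qed.

Lemma dyadic_le1 (R : realType) (t : R) : 0 < t <= 1 ->
  exists k, 2^-1 ^+ k.+1 <= t <= 2^-1 ^+ k.
Proof.
move=> /andP[t0 t1].
have /dyadic_ge1[k /andP[lo hi]] : 1 <= t^-1 by rewrite invf_ge1.
exists k; rewrite !exprVn.
by rewrite invf_ple ?posrE ?exprn_gt0// (ltW hi) invf_pge ?posrE ?exprn_gt0.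
Qed.

Lemma powR_expr (R : realType) (x s : R) k : 0 <= x ->
  (x ^+ k) `^ s = (x `^ s) ^+ k.
Proof.
by move=> x0; rewrite -[in LHS]powR_mulrn// powRAC powR_mulrn ?powR_ge0.
Qed.

(** * Integrability of the majorant *)

Lemma powR_half_lt1 (R : realType) (s : R) : 0 < s -> 2^-1 `^ s < 1 :> R.
Proof.
move=> s0; rewrite [ltRHS](_ : 1 = 1 `^ s); last by rewrite powR1.
by apply: gt0_ltr_powR; rewrite // ?nnegrE ?invr_ge0//; lra.
Qed.

Lemma ler_powRN (R : realType) (x y s : R) : 0 < x -> x <= y -> 0 <= s ->
  y `^ (- s) <= x `^ (- s).
Proof.
move=> x0 xy s0; have y0 := lt_le_trans x0 xy.
rewrite !powRN lef_pV2 ?posrE ?powR_gt0//.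
by rewrite ge0_ler_powR// nnegrE ltW.
Qed.

Lemma measurable_split_power_eucl_norm (R : realType) N (al be : R) D :
  measurable_fun D (fun y : N.-tuple R =>
    (Num.min 1 (eucl_norm y) * split_power N al be (eucl_norm y))%:E).
Proof.
apply: measurable_funTS; apply/measurable_EFinP/measurable_funM.
  by apply: measurable_minr => //; exact: measurable_eucl_norm.
exact: (measurableT_comp (measurable_split_power N al be)
  (@measurable_eucl_norm R N)).
Qed.

Lemma split_power_integral_ball_lty (R : realType) N (al be : R) : 0 < be < 1 ->
  (\int[@lebesgue_tuple R N]_(y in [set y | (eucl_norm y < 1)%R])
     (Num.min 1 (eucl_norm y) * split_power N al be (eucl_norm y))%:E < +oo)%E.
Proof.
move=> /andP[be0 be1].
pose r k : R := 2^-1 ^+ k.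
have r0 k : 0 < r k by rewrite exprn_gt0// invr_gt0.
pose q : R := 2^-1 `^ (1 - be).
(* On the shell r k.+1 <= |y| <= r k the factor min(1, |y|) is at most r k, and
   the power, whose exponent is negative, is largest at the inner radius. *)
apply: (@integral_cover_lty _ _ _ _ _ _ (fun k => cube (r k))
  (fun k => r k * r k.+1 `^ (- N%:R - be)) (2 * 4 ^+ N * q) q).
- rewrite -[X in measurable X]setTI.
  by apply: (measurable_eucl_norm measurableT (measurable_itv `]-oo, 1[)).
- exact: measurable_split_power_eucl_norm.
- move=> y _; rewrite lee_fin mulr_ge0 ?split_power_ge0// le_min ler01.
  exact: sqrtr_ge0.
- by move=> k; exact: measurable_cube.
- by move=> k; rewrite mulr_ge0 ?powR_ge0// ltW.
- move=> k; rewrite /= lebesgue_tuple_cube ?ltW// -EFinM; congr EFin.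
  have -> : r k = 2 * r k.+1 by rewrite /r exprS mulrA divff ?mul1r.
  have -> : 2 * 4 ^+ N * q * q ^+ k = 2 * 4 ^+ N * r k.+1 `^ (1 - be).
    by rewrite -mulrA -exprS /r powR_expr// invr_ge0.
  have -> : 2 * (2 * r k.+1) = 4 * r k.+1 by ring.
  have -> : 1 - be = 1 + N%:R + (- N%:R - be) by ring.
  have rD s t : r k.+1 `^ (s + t) = r k.+1 `^ s * r k.+1 `^ t.
    by rewrite powRD// (gt_eqF (r0 _)) implybT.
  by rewrite exprMn (rD (1 + N%:R)) (rD 1) powRr1 ?powR_mulrn ?ltW//; ring.
- by rewrite powR_ge0 powR_half_lt1// subr_gt0.
move=> y /= y1; have [y0|y0] := ltP 0 (eucl_norm y).
  have [k /andP[rk kr]] : exists k, r k.+1 <= eucl_norm y <= r k.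
    by apply: dyadic_le1; rewrite y0 ltW.
  exists k; first exact: eucl_norm_cube.
  rewrite lee_fin ler_pM ?le_min ?ler01 ?sqrtr_ge0 ?split_power_ge0//.
    by rewrite ge_min kr orbT.
  by rewrite /split_power y1 -opprD ler_powRN// addr_ge0// ltW.
(* At the origin the integrand vanishes, and any cube of the cover will do. *)
exists 0%N.
  by apply: eucl_norm_cube; rewrite /r expr0 ltW.
have -> : eucl_norm y = 0 by apply/eqP; rewrite eq_le y0 sqrtr_ge0.
by rewrite minEle ler10 mul0r lee_fin mulr_ge0 ?powR_ge0// ltW.
Qed.

Lemma split_power_integral_setC_ball_lty (R : realType) N (al be : R) : 0 < al ->
  (\int[@lebesgue_tuple R N]_(y in ~` [set y | (eucl_norm y < 1)%R])
     (Num.min 1 (eucl_norm y) * split_power N al be (eucl_norm y))%:E < +oo)%E.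
Proof.
move=> al0; pose r k : R := 2 ^+ k.
have r0 k : 0 < r k by rewrite exprn_gt0.
pose q : R := 2 `^ (- al).
(* The shell r k <= |y| <= r k.+1 needs the cube of its outer radius, while the
   power is bounded by its value at the inner one. *)
apply: (@integral_cover_lty _ _ _ _ _ _ (fun k => cube (r k.+1))
  (fun k => r k `^ (- N%:R - al)) (4 ^+ N) q).
- apply: measurableC; rewrite -[X in measurable X]setTI.
  by apply: (measurable_eucl_norm measurableT (measurable_itv `]-oo, 1[)).
- exact: measurable_split_power_eucl_norm.
- move=> y _; rewrite lee_fin mulr_ge0 ?split_power_ge0// le_min ler01.
  exact: sqrtr_ge0.
- by move=> k; exact: measurable_cube.
- by move=> k; exact: powR_ge0.
- move=> k; rewrite /= lebesgue_tuple_cube ?ltW// -EFinM; congr EFin.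
  have -> : 2 * r k.+1 = 4 * r k by rewrite /r exprS; ring.
  have -> : q ^+ k = r k `^ N%:R * r k `^ (- N%:R - al).
    rewrite -powRD ?(gt_eqF (r0 k)) ?implybT// addrA subrr sub0r.
    by rewrite /r powR_expr.
  by rewrite exprMn powR_mulrn ?ltW//; ring.
- have -> : q = 2^-1 `^ al by rewrite /q -powR_inv1// -powRrM mulN1r.
  by rewrite powR_ge0 powR_half_lt1.
move=> y /= /negP; rewrite -leNgt => y1.
have [k /andP[rk /ltW kr]] := dyadic_ge1 y1.
exists k; first exact: eucl_norm_cube.
rewrite lee_fin -[leRHS]mul1r ler_pM ?le_min ?ler01 ?sqrtr_ge0 ?split_power_ge0//.
  by rewrite ge_min lexx.
by rewrite /split_power ltNge y1/= -opprD ler_powRN// addr_ge0// ltW.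
Qed.

Lemma split_power_integral_lty (R : realType) N (al be : R) :
  0 < al -> 0 < be < 1 ->
  (\int[@lebesgue_tuple R N]_y
     (Num.min 1 (eucl_norm y) * split_power N al be (eucl_norm y))%:E < +oo)%E.
Proof.
move=> al0 be01; rewrite -(setUv [set y : N.-tuple R | eucl_norm y < 1]).
have mD : measurable [set y : N.-tuple R | eucl_norm y < 1].
  rewrite -[X in measurable X]setTI.
  by apply: (measurable_eucl_norm measurableT (measurable_itv `]-oo, 1[)).
rewrite ge0_integral_setU//=.
- apply: lte_add_pinfty; first exact: split_power_integral_ball_lty.
  exact: split_power_integral_setC_ball_lty.
- exact: measurableC.
- exact: measurable_split_power_eucl_norm.
- move=> y _; rewrite lee_fin mulr_ge0 ?split_power_ge0// le_min ler01.
  exact: sqrtr_ge0.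
- by apply/disj_setPCl.
Qed.

(** * The exponent *)

Lemma locally_lipschitz_continuous_normr (R : realType) (f : R -> R) :
  locally_lipschitz_on `[0, +oo[ f -> continuous (fun x : R => f `|x|).
Proof.
move=> lf x; have x0 : (`[0, +oo[%classic : set R) `|x|.
  by rewrite /= in_itv/= andbT.
apply: cvg_comp (locally_lipschitz_cvg lf x0) => P wP.
have Px : \forall y \near x, (`[0, +oo[%classic : set R) `|y| -> P `|y|.
  exact: (@norm_continuous _ _ x _ wP).
suff : \forall y \near x, P `|y| by [].
apply: filterS Px => y; apply.
by rewrite /= in_itv/= andbT.
Qed.

Lemma measurable_powR_pair d (T : measurableType d) (R : realType)
    (f g : T -> R) : measurable_fun setT f -> measurable_fun setT g ->
  measurable_fun setT (fun x => f x `^ g x).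
Proof.
move=> mf mg; rewrite /powR; apply: measurable_fun_ifT.
- exact: measurable_fun_eqr.
- rewrite [X in measurable_fun _ X](_ : _ = fun x => if g x == 0 then 1 else 0).
    by apply: measurable_fun_ifT => //; exact: measurable_fun_eqr.
  by apply/funext => x; case: (g x == 0).
- apply: measurableT_comp => //; apply: measurable_funM => //.
  exact: measurableT_comp.
Qed.

Section piecewise_exponent.
Context {R : realType} (Psi1 Psi2 Theta : R -> R).

Lemma piecewise_exponentE s z :
  piecewise_exponent Psi1 Psi2 Theta s z =
    (if z < 1 then Psi1 s else Psi2 s) + Theta z.
Proof.
rewrite /piecewise_exponent !indicE; have [z1|z1] := ltP z 1.
  by rewrite mem_set// memNset ?mulr1 ?mulr0 ?addr0//= leNgt z1.
by rewrite memNset ?[z \in _]mem_set ?mulr1 ?mulr0 ?add0r//= ltNge z1.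
Qed.

Lemma continuous_piecewise_exponent z :
  locally_lipschitz_on `[0, +oo[ Psi1 -> locally_lipschitz_on `[0, +oo[ Psi2 ->
  continuous (fun x : R => piecewise_exponent Psi1 Psi2 Theta `|x| z).
Proof.
move=> l1 l2 x; under eq_fun do rewrite piecewise_exponentE.
apply: cvgD; last exact: cvg_cst.
by case: ifP => _; exact: locally_lipschitz_continuous_normr.
Qed.

Lemma measurable_piecewise_exponent d (T : measurableType d) (s z : T -> R) :
  locally_lipschitz_on `[0, +oo[ Psi1 -> locally_lipschitz_on `[0, +oo[ Psi2 ->
  measurable_fun (`[0, +oo[%classic : set R) Theta ->
  (forall x, 0 <= z x) ->
  measurable_fun setT s -> measurable_fun setT z ->
  measurable_fun setT
    (fun x => piecewise_exponent Psi1 Psi2 Theta `|s x| (z x)).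
Proof.
move=> l1 l2 mTheta z0 ms mz; under eq_fun do rewrite piecewise_exponentE.
have ms_comp (f : R -> R) : locally_lipschitz_on `[0, +oo[ f ->
    measurable_fun setT (fun x => f `|s x|).
  move=> /locally_lipschitz_continuous_normr/continuous_measurable_fun mf.
  exact: (measurableT_comp mf ms).
apply: measurable_funD.
  by apply: measurable_fun_ifT; [exact: measurable_fun_ltr| |]; exact: ms_comp.
apply: measurable_comp mTheta mz => //.
by move=> _ [x _ <-]; rewrite /= in_itv/= andbT.
Qed.

Lemma lipschitz_piecewise_exponent r :
  locally_lipschitz_on `[0, +oo[ Psi1 -> locally_lipschitz_on `[0, +oo[ Psi2 ->
  exists2 k, 0 <= k & forall s t z, 0 <= s <= r -> 0 <= t <= r ->
    `|piecewise_exponent Psi1 Psi2 Theta s z -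
      piecewise_exponent Psi1 Psi2 Theta t z| <= k * `|s - t|.
Proof.
have sub : `[0, r]%classic `<=` (`[0, +oo[%classic : set R).
  by move=> x /=; rewrite !in_itv/= => /andP[->].
move=> /(locally_lipschitz_onS sub)/compact_locally_lipschitz[].
  exact: segment_compact.
move=> k k0 lk /(locally_lipschitz_onS sub)/compact_locally_lipschitz[].
  exact: segment_compact.
move=> l l0 ll; exists (k + l) => [|s t z s0r t0r].
  by rewrite addr_ge0// ltW.
rewrite !piecewise_exponentE opprD addrACA subrr addr0 mulrDl.
case: ifPn => _.
  by rewrite ler_wpDr ?lk ?mulr_ge0// ltW.
by rewrite ler_wpDl ?ll ?mulr_ge0// ltW.
Qed.

End piecewise_exponent.

Lemma eucl_distC (R : realType) N (x y : N.-tuple R) :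
  eucl_dist x y = eucl_dist y x.
Proof.
by congr Num.sqrt; apply: eq_bigr => i _; rewrite -sqrrN opprB.
Qed.

(** * The jump kernel *)

Theorem proposition5p10 (R : realType) (N : nat) (N_gt0 : (0 < N)%N)
    (Psi1 Psi2 Theta : R -> R) (A1 A2 : R)
    (Psi1_nondecreasing : {in `[0, +oo[ &, {homo Psi1 : s t / s <= t}})
    (Psi2_nonincreasing : {in `[0, +oo[ &, {homo Psi2 : s t /~ s <= t}})
    (Psi1_lipschitz : locally_lipschitz_on `[0, +oo[ Psi1)
    (Psi2_lipschitz : locally_lipschitz_on `[0, +oo[ Psi2)
    (Theta_measurable : measurable_fun (`[0, +oo[%classic : set R) Theta)
    (A1_gt0 : 0 < A1) (A2_lt1 : A2 < 1)
    (Psi_bounds : forall s z : R, 0 <= s -> 0 <= z ->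
      A1 <= piecewise_exponent Psi1 Psi2 Theta s z <= A2)
    (Theta_bounds : forall z : R, 0 <= z -> A1 <= Theta z <= A2) :
  homogeneous_jump_kernel
    (fun p : (R * R) * (N.-tuple R * N.-tuple R) =>
       eucl_dist p.2.1 p.2.2 `^
         (- N%:R - piecewise_exponent Psi1 Psi2 Theta
                     `|p.1.1 - p.1.2| (eucl_dist p.2.1 p.2.2))).
Proof.
pose Psi := piecewise_exponent Psi1 Psi2 Theta.
have A12 : A1 <= A2.
  by have /andP[A1T TA2] := Theta_bounds 0 (lexx _); exact: le_trans TA2.
have NPsi0 s z : 0 <= s -> 0 <= z -> - N%:R - Psi s z != 0.
  move=> s0 z0; have /andP[A1P _] := Psi_bounds s z s0 z0.
  by rewrite -opprD oppr_eq0 gt_eqF// ltr_wpDl// (lt_le_trans A1_gt0).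
have Psi_A12 (a b z : R) : 0 <= z -> A1 <= Psi `|a - b| z <= A2.
  by move=> z0; exact: Psi_bounds.
(* Midpoints of ]0, A1[ and of ]A2, 1[. *)
pose al := A1 / 2; pose be := (1 + A2) / 2.
have al0 : 0 < al by rewrite divr_gt0.
have alA1 : al < A1 by rewrite /al; lra.
have A2be : A2 < be by rewrite /be; lra.
have be01 : 0 < be < 1 by rewrite /be; apply/andP; split; lra.
have dist0 (x y : N.-tuple R) : 0 <= eucl_dist x y by exact: sqrtr_ge0.
split.
- by move=> p; exact: powR_ge0.
- apply: measurable_powR_pair.
    apply: (measurableT_comp (@measurable_eucl_dist R N)).
    exact: measurable_snd.
  apply: measurable_funB => //; apply: measurable_piecewise_exponent => //.
    apply: measurable_funB.
      by apply: measurableT_comp measurable_fst; exact: measurable_fst.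
    by apply: measurableT_comp measurable_fst; exact: measurable_snd.
  apply: (measurableT_comp (@measurable_eucl_dist R N)).
  exact: measurable_snd.
- by apply: aeW => xy a b /=; rewrite distrC eucl_distC.
- apply: aeW => -[x y] a b c d dc ca bd /=.
  rewrite !ger0_norm ?subr_ge0 ?(le_trans bd (le_trans dc ca))//.
  have cd_ab : c - d <= a - b by lra.
  apply: ler_pM; rewrite ?subr_ge0 ?powR_ge0//.
  have cd0 : 0 <= c - d by rewrite subr_ge0.
  have ab0 : 0 <= a - b by exact: le_trans cd_ab.
  have := dist0 x y; rewrite le_eqVlt => /predU1P[<-|z0].
    by rewrite !powR0 ?NPsi0.
  have mem (s : R) : 0 <= s -> s \in `[0, +oo[ by rewrite in_itv/= andbT.
  rewrite !piecewise_exponentE; have [z1|z1] := ltP (eucl_dist x y) 1.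
    rewrite ger_powR ?z0 ?(ltW z1)// lerD2l lerN2 lerD2r.
    by apply: Psi1_nondecreasing => //; exact: mem.
  rewrite ler_powR// lerD2l lerN2 lerD2r.
  by apply: Psi2_nonincreasing => //; exact: mem.
- exists (fun a b z => z `^ (- N%:R - Psi `|a - b| z)).
  exact: aeW.
- apply: aeW => -[x y] [a b] /=.
  have := dist0 x y; rewrite le_eqVlt => /predU1P[<-|z0].
    under eq_fun do rewrite powR0 ?NPsi0//.
    exact: cvg_cst.
  set z := eucl_dist x y in z0 *.
  pose g (u : R) := expR ((- N%:R - Psi `|u| z) * ln z).
  have cg : continuous g.
    move=> u; apply: continuous_comp; last exact: continuous_expR.
    apply: cvgMl; apply: cvgB; first exact: cvg_cst.
    exact: continuous_piecewise_exponent.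
  under eq_fun do rewrite /powR gt_eqF//.
  apply: (@continuous_comp _ _ _ (fun ab : R * R => ab.1 - ab.2) g); last exact: cg.
  by apply: cvgB; [exact: cvg_fst|exact: cvg_snd].
exists (fun=> split_power N al be); split=> [r r0|eps r eps0 epsr].
  split.
  - by move=> t _; exact: split_power_ge0.
  - by apply: measurable_funTS; exact: measurable_split_power.
  - apply: aeW => -[x y]; apply: ge_ereal_sup => _ [a _ [b _ <-]] /=.
    rewrite lee_fin; apply: (powR_le_split_power (A1 := A1) (A2 := A2)) => //.
      exact: NPsi0.
    exact: Psi_A12.
  - exact: split_power_integral_lty.
(* The increments |a - b| and |c - d| range over [0, 2 r]. *)
have [k k0 lipPsi] := lipschitz_piecewise_exponent Theta (2 * r)
  Psi1_lipschitz Psi2_lipschitz.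
exists (((be - A2)^-1 + (A1 - al)^-1) * k).
apply: aeW => -[x y] a b c d ar br cr dr _ _ /=.
have dist_le (s t : R) : s \in `[- r, r] -> t \in `[- r, r] ->
    0 <= `|s - t| <= 2 * r.
  rewrite !in_itv/= normr_ge0 ler_norml => /andP[? ?] /andP[? ?].
  by apply/andP; split; lra.
apply: le_trans (powR_dist_split_power alA1 A2be _ _ _ _ _) _ => //.
- exact: NPsi0.
- exact: NPsi0.
- exact: Psi_A12.
- exact: Psi_A12.
rewrite ler_wpM2r ?split_power_ge0// -mulrA ler_wpM2l//.
  by rewrite addr_ge0// invr_ge0 ltW// subr_gt0.
rewrite (le_trans (lipPsi _ _ _ _ _))// ?dist_le// ler_wpM2l//.
rewrite (le_trans (ler_dist_dist _ _))//.
have -> : a - b - (c - d) = (a - c) - (b - d) by ring.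
exact: ler_normB.
Qed.
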